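(* Let $t$ be an integer with $t\geq 8$. Then $$\operatorname{gr}_4(P_5:PA_{t,5})=4t-3 .$$
   Context: All graphs are finite, simple and undirected. $K_n$ is the complete graph on $n$ vertices and $P_5$ is the path with $5$ vertices and $4$ edges. For $t\geq\omega+1$, the pineapple $PA_{t,\omega}$ is the graph of order $t$ obtained from the complete graph $K_\omega$ by attaching $t-\omega$ pendent vertices to one and the same vertex of $K_\omega$. A $k$-edge-coloring assigns to each edge one of $k$ colors; all $k$-edge-colorings are assumed exact, i.e. each of the $k$ colors is used at least once. An edge-colored graph is rainbow if all its edges have different colors and monochromatic if all its edges have a single color. A copy of a graph means a (not necessarily induced) subgraph isomorphic to it. For non-empty graphs $G,H$ (graphs with at least one edge) and a positive integer $k$, the Gallai-Ramsey number $\operatorname{gr}_k(G:H)$ is the minimum integer $N$ with $\binom{N}{2}\geq k$ (so that $K_N$ admits a $k$-edge-coloring) such that for all $n\geq N$, every $k$-edge-coloring of $K_n$ contains either a rainbow copy of $G$ or a monochromatic copy of $H$. *)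

(* Defs.v *)
From HB Require Import structures.
From mathcomp Require Import all_boot.

Set Implicit Arguments.
Unset Strict Implicit.
Unset Printing Implicit Defensive.

Record sgraph := SGraph {
  vertex :> finType;
  adj : rel vertex;
  adj_sym : symmetric adj;
  adj_irr : irreflexive adj }.

Definition edges (G : sgraph) : {set {set G}} :=
  [set [set p.1; p.2] | p : G * G & adj p.1 p.2].

Definition complete_rel n : rel 'I_n := fun x y => x != y.

Lemma complete_rel_sym n : symmetric (@complete_rel n).
Proof. by move=> x y; rewrite /complete_rel eq_sym. Qed.

Lemma complete_rel_irr n : irreflexive (@complete_rel n).
Proof. by move=> x; rewrite /complete_rel eqxx. Qed.

Definition complete_graph n : sgraph :=
  SGraph (@complete_rel_sym n) (@complete_rel_irr n).

Definition path_rel n : rel 'I_n :=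
  fun x y => (y == x.+1 :> nat) || (x == y.+1 :> nat).

Lemma path_rel_sym n : symmetric (@path_rel n).
Proof. by move=> x y; rewrite /path_rel orbC. Qed.

Lemma path_rel_irr n : irreflexive (@path_rel n).
Proof. by move=> x; rewrite /path_rel orbb ltn_eqF. Qed.

(* n is the number of vertices *)
Definition path_graph n : sgraph :=
  SGraph (@path_rel_sym n) (@path_rel_irr n).

(* The vertices below w form the complete graph K_w; the t - w remaining ones
   are pendent vertices attached to the vertex 0 of K_w.  Meaningful for
   0 < w < t. *)
Definition pineapple_rel t w : rel 'I_t := fun x y =>
  (x != y) && [|| (x < w) && (y < w),
    (x == 0 :> nat) && (w <= y) | (y == 0 :> nat) && (w <= x)].

Lemma pineapple_rel_sym t w : symmetric (@pineapple_rel t w).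
Proof.
move=> x y; rewrite /pineapple_rel (eq_sym y x) [(y < w) && _]andbC.
by rewrite [(y == 0 :> nat) && _ || _]orbC.
Qed.

Lemma pineapple_rel_irr t w : irreflexive (@pineapple_rel t w).
Proof. by move=> x; rewrite /pineapple_rel eqxx. Qed.

Definition pineapple t w : sgraph :=
  SGraph (@pineapple_rel_sym t w) (@pineapple_rel_irr t w).

(* f embeds a copy of G, as a not necessarily induced subgraph, into F *)
Definition is_copy (G F : sgraph) (f : G -> F) : Prop :=
  injective f /\ forall x y : G, adj x y -> adj (f x) (f y).

(* A k-edge-coloring of F is encoded as a function on all sets of vertices;
   only its values on [edges F] are ever used. *)
Definition edge_coloring (F : sgraph) (k : nat) := {set F} -> 'I_k.

Definition exact (F : sgraph) k (c : edge_coloring F k) : Prop :=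
  forall a : 'I_k, exists2 e, e \in edges F & c e = a.

Definition has_rainbow (G F : sgraph) k (c : edge_coloring F k) : Prop :=
  exists2 f : G -> F, is_copy f &
    {in edges G &, injective (fun e : {set G} => c (f @: e))}.

Definition has_monochromatic (H F : sgraph) k (c : edge_coloring F k) : Prop :=
  exists2 f : H -> F, is_copy f &
    exists a : 'I_k, {in edges H, forall e : {set H}, c (f @: e) = a}.

Definition gallai_ramsey_bound (k : nat) (G H : sgraph) (N : nat) : Prop :=
  k <= 'C(N, 2) /\
  forall n, N <= n -> forall c : edge_coloring (complete_graph n) k,
    exact c -> has_rainbow G c \/ has_monochromatic H c.

(* gr_k(G : H) = N *)
Definition is_gallai_ramsey (k : nat) (G H : sgraph) (N : nat) : Prop :=
  gallai_ramsey_bound k G H N /\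
  forall M, gallai_ramsey_bound k G H M -> N <= M.

(* Main.v *)
Require Import Defs.
From HB Require Import structures.
From mathcomp Require Import all_boot.
From mathcomp Require Import zify.

(** Lower bound: four blocks of t - 1 vertices, colour 0 between blocks and
    colours 1, 2, 3, 1 inside them.

    Upper bound: consider an exact 4-colouring without rainbow P_5.
    If some vertex is the centre of a rainbow claw, then some edge of the fourth
    colour meets the claw, and a finite search shows that all edges outside the
    claw and one further vertex have the same colour, which leaves a
    monochromatic clique on n - 5 >= t vertices.
    Otherwise every vertex sees at most two colours, and as the sets of colours
    seen by two vertices intersect, they have a common element d: the vertices split
    into three parts such that edges between parts have colour d and edges inside
    the i-th part have colour d or i.  If there is no pineapple, then d contains
    no triangle inside a part (extend it to a K_5 by the two other parts), so
    every part has at most 2t - 2 vertices because R(3, 5) <= 15 <= 2t - 1; and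
    at most one part contains an edge of colour d, so the two others are
    monochromatic cliques on at most t - 1 vertices.  Hence n <= 4t - 4. *)

Set Implicit Arguments.
Unset Strict Implicit.
Unset Printing Implicit Defensive.

(** * Exhaustive search over colour sequences with pruning *)

Section Search.
Variables (P Q : pred (seq nat)).

(* The filter, unlike an implication, also prunes under call-by-value. *)
Fixpoint extensions_satisfy k s : bool :=
  if k is k'.+1 then
    all (extensions_satisfy k') [seq s' <- [seq rcons s x | x <- iota 0 4] | P s']
  else Q s.

Lemma extensions_satisfyP k s u :
    extensions_satisfy k s -> size u = k -> all (fun x => x < 4) u ->
    (forall i, 0 < i <= k -> P (s ++ take i u)) -> Q (s ++ u).
Proof.
elim: k s u => [|k IHk] s [|x u] //; first by rewrite cats0.
move=> /allP sP [szu] /andP[x4 u4] Pu.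
rewrite -cat_rcons; apply: IHk => //.
- have Px : P (rcons s x) by have := Pu 1 isT; rewrite /= take0 cats1.
  by apply: sP; rewrite mem_filter Px; apply: map_f; rewrite mem_iota.
- by move=> i /andP[_ ik]; rewrite cat_rcons; exact: (Pu i.+1).
Qed.

End Search.

(* The colours of a K_7 on the vertices 0, ..., 6 are listed as a sequence of 21
   slots: first the claw at 0, then the other edges inside {0, 1, 2, 3}, then
   the edges from 4, 5 and 6 to the preceding vertices. *)
Definition slot_pairs : seq (nat * nat) :=
  [:: (0, 1); (0, 2); (0, 3); (1, 2); (1, 3); (2, 3)]
  ++ [seq (i, j) | j <- iota 4 3, i <- iota 0 j].

Definition slot i j := index (minn i j, maxn i j) slot_pairs.

(** Comparing the two ends keeps one orientation of each path. *)
Definition five_paths : seq (seq nat) :=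
  [seq p <- iter 5 (fun ps =>
                [seq i :: p | i <- iota 0 7, p <- [seq p <- ps | i \notin p]]) [:: [::]]
  | head 0 p < last 0 p].

(** [pairmap] also pairs the first vertex with the dummy start 0; [behead] drops that entry. *)
Definition path_slots p := behead (pairmap slot 0 p).

(* The k-th entry lists the paths, as sequences of slots, whose last slot to be
   coloured is k; the default 0 in [nth] below is therefore never used. *)
Definition closing_paths : seq (seq (seq nat)) :=
  Eval vm_compute in
    [seq [seq e <- map path_slots five_paths | foldr maxn 0 e == k] | k <- iota 0 21].

(** The search tests every prefix in turn, so only the paths completed by the newest slot have to be
    examined. *)
Definition no_rainbow_closing s :=
  all (fun e => ~~ uniq [seq nth 0 s i | i <- e])
    (nth [::] closing_paths (size s).-1).

Definition determines_last_slot s :=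
  has (fun q => extensions_satisfy no_rainbow_closing
                  (fun s' => last 0 s' == q) 11 s) (iota 0 4).

(** The first ten slots form the K_5 on the claw and vertex 4. Once colour 3 occurs there, these ten
    colours force the colour of the last slot, which is the edge between 5 and 6, whatever the
    eleven remaining slots are. *)
Lemma claw_search :
  extensions_satisfy no_rainbow_closing
    (fun s => if 3 \in s then determines_last_slot s else true) 7 [:: 0; 1; 2].
Proof. by vm_compute. Qed.

Lemma slot_pairs_mem i j :
  i < 7 -> j < 7 -> i != j -> (minn i j, maxn i j) \in slot_pairs.
Proof.
move=> i7 j7 ij.
have /allP/(_ i) : all (fun i => all (fun j => (i == j) || ((minn i j, maxn i j) \in slot_pairs))
  (iota 0 7)) (iota 0 7) by vm_compute.
rewrite mem_iota => /(_ i7)/allP/(_ j).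
by rewrite mem_iota (negbTE ij) => /(_ j7).
Qed.

(** * Colourings with a rainbow claw *)

Section Claw.
Variables (T : eqType) (f : T -> T -> nat).
Hypothesis f_sym : forall x y, f x y = f y x.
Hypothesis f_lt4 : forall x y, f x y < 4.
Hypothesis f_norainbow : forall x p,
  uniq (x :: p) -> size p = 4 -> ~~ uniq (pairmap f x p).

Section SlotColors.
Variables (p : seq T) (x0 : T).
Hypotheses (p_uniq : uniq p) (p_size : size p = 7).

Definition slot_colors := [seq f (nth x0 p q.1) (nth x0 p q.2) | q <- slot_pairs].

Lemma nth_slot_colors i j : i < 7 -> j < 7 -> i != j ->
  nth 0 slot_colors (slot i j) = f (nth x0 p i) (nth x0 p j).
Proof.
move=> i7 j7 ij; have ijm := slot_pairs_mem i7 j7 ij.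
rewrite (nth_map (0, 0)) ?index_mem // nth_index //=.
by case: (leqP i j) => _; rewrite // f_sym.
Qed.

Lemma pairmap_slot_colors i q : all (fun k => k < 7) (i :: q) -> uniq (i :: q) ->
  [seq nth 0 slot_colors k | k <- pairmap slot i q] =
  pairmap f (nth x0 p i) [seq nth x0 p k | k <- q].
Proof.
elim: q i => [//|j q IHq] i /and3P[i7 j7 q7] /andP[].
rewrite inE negb_or => /andP[ij _] jq /=.
by rewrite nth_slot_colors // IHq //= j7.
Qed.

Lemma no_rainbow_closing_slot_colors k :
  0 < k <= 21 -> no_rainbow_closing (take k slot_colors).
Proof.
case: k => // k k21; apply/allP => e.
(* The table is stored in evaluated form; its defining expression is restored so that membership can
   be analysed. *)
have -> : closing_paths =
  [seq [seq e <- map path_slots five_paths | foldr maxn 0 e == k] | k <- iota 0 21].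
  by vm_compute.
rewrite size_takel ?size_map // [_.-1]/= (nth_map 0) ?size_iota // nth_iota // add0n mem_filter.
case/andP => /eqP e_max /mapP[[|i q] qP def_e].
  by move: qP; rewrite mem_filter.
have /allP/(_ _ qP) : all (fun r => [&& size r == 5, uniq r & all (fun k => k < 7) r]) five_paths.
  by vm_compute.
case/and3P=> [/eqP[szq] uq q7].
have -> : [seq nth 0 (take k.+1 slot_colors) l | l <- e] = [seq nth 0 slot_colors l | l <- e].
  apply/eq_in_map => l le; apply: nth_take; rewrite ltnS -e_max.
  elim: (e) le => //= a r IHr; rewrite inE leq_max.
  by case/predU1P => [->|/IHr ->]; rewrite ?leqnn ?orbT.
rewrite def_e /path_slots /= pairmap_slot_colors //.
apply: f_norainbow; last by rewrite size_map.
rewrite -(map_cons (nth x0 p)) map_inj_in_uniq // => a b aq bq /eqP.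
by rewrite nth_uniq ?p_size; [move/eqP| exact: (allP q7)| exact: (allP q7)|].
Qed.

End SlotColors.

Lemma claw_monochromatic v w1 w2 w3 x y1 y2 z1 z2 :
  let s := [:: v; w1; w2; w3; x] in
  f v w1 = 0 -> f v w2 = 1 -> f v w3 = 2 ->
  (exists a b, [/\ a \in s, b \in s, a != b & f a b = 3]) ->
  uniq (s ++ [:: y1; y2]) -> uniq (s ++ [:: z1; z2]) -> f y1 y2 = f z1 z2.
Proof.
move=> s fw1 fw2 fw3 ab3 y_uniq z_uniq.
pose u a b := slot_colors (s ++ [:: a; b]) v.
have uE a b : u a b = [:: 0; 1; 2] ++ drop 3 (u a b).
  by rewrite /u /slot_colors /= fw1 fw2 fw3.
have u_size a b : size (u a b) = 21 by rewrite size_map.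
have u_lt4 a b : all (fun k => k < 4) (u a b).
  by apply/allP => k /mapP[q _ ->].
have u_ok a b : uniq (s ++ [:: a; b]) -> forall k, 0 < k <= 21 ->
    no_rainbow_closing (take k (u a b)).
  by move=> ab_uniq k; apply: no_rainbow_closing_slot_colors.
(* The first ten slots involve only the claw and [x], so [r] does not depend on the last two
   vertices, and the colour [q] that it forces serves both pairs. *)
pose r := take 10 (u y1 y2).
have rE a b : r = take 10 (u a b) by [].
have r3 : 3 \in r.
  case: ab3 => _ [_] [/(nthP v)[i i5 <-] /(nthP v)[j j5 <-] + fij].
  rewrite nth_uniq //; last by move: y_uniq; rewrite cat_uniq => /andP[].
  move=> ij; have slot10 : slot i j < 10.
    have /allP/(_ i) : all (fun i => all (fun j => (i == j) || (slot i j < 10))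
      (iota 0 5)) (iota 0 5) by vm_compute.
    rewrite mem_iota => /(_ i5)/allP/(_ j).
    by rewrite mem_iota (negbTE ij) => /(_ j5).
  have <- : nth 0 r (slot i j) = 3.
    rewrite nth_take // nth_slot_colors //; try exact: ltn_trans (_ : 5 < 7).
    by rewrite !nth_cat i5 j5.
  by apply: mem_nth; rewrite size_takel ?u_size.
have : if 3 \in r then determines_last_slot r else true.
  have rE3 : r = [:: 0; 1; 2] ++ take 7 (drop 3 (u y1 y2)) by rewrite /r uE.
  rewrite rE3; apply: (extensions_satisfyP claw_search).
  - by rewrite size_takel // size_drop u_size.
  - by apply/allP => k /mem_take/mem_drop; exact: (allP (u_lt4 _ _)).
  - move=> i /andP[_ i7]; rewrite take_takel //.
    have -> : [:: 0; 1; 2] ++ take i (drop 3 (u y1 y2)) = take (3 + i) (u y1 y2).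
      by rewrite [in RHS]uE.
    by apply: u_ok => //; lia.
rewrite r3 => /hasP[q _ last_q].
have lastE a b : uniq (s ++ [:: a; b]) -> f a b = q.
  move=> ab_uniq; have -> : f a b = last 0 (r ++ drop 10 (u a b)) by [].
  apply/eqP; apply: (extensions_satisfyP last_q).
  - by rewrite size_drop u_size.
  - by apply/allP => k /mem_drop; exact: (allP (u_lt4 _ _)).
  move=> i /andP[_ i11]; rewrite (rE a b).
  have -> : take 10 (u a b) ++ take i (drop 10 (u a b)) = take (10 + i) (u a b).
    by rewrite takeD.
  by apply: u_ok => //; lia.
by rewrite !lastE.
Qed.

(** Otherwise the edge xy of colour 3 avoids the claw. Paths starting with xy and running through v
    force the colours of x w1, x w2, y w2 and y w3 to be 0, 1, 1, 2. The paths w1 x y w2 w3 and w1 x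
    y w3 w2 then force colour 0 on w2 w3, and y x w2 w3 v is rainbow. *)
Lemma claw_meets_fourth_color v w1 w2 w3 x y :
  let s := [:: v; w1; w2; w3] in
  uniq s -> f v w1 = 0 -> f v w2 = 1 -> f v w3 = 2 -> x != y -> f x y = 3 ->
  ~ (forall w z, w \in s -> w != z -> f w z != 3).
Proof.
move=> s s_uniq fw1 fw2 fw3 nxy fxy no3.
have xs : x \notin s by apply/negP => xs; have := no3 x y xs nxy; rewrite fxy.
have ys : y \notin s.
  by apply/negP => ys; have := no3 y x ys; rewrite eq_sym nxy f_sym fxy => /(_ isT).
have r_uniq : uniq (s ++ [:: x; y]).
  by rewrite cat_uniq s_uniq /= !orbF negb_or xs ys inE nxy.
pose r := nth v (s ++ [:: x; y]).
have no_path i q : [&& uniq (i :: q), size q == 4 & all (fun k => k < 6) (i :: q)] ->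
    ~~ uniq (pairmap f (r i) [seq r k | k <- q]).
  case/and3P => iq_uniq /eqP szq /allP iq6; apply: f_norainbow; last by rewrite size_map.
  rewrite -(map_cons r) map_inj_in_uniq // => a b /iq6 a6 /iq6 b6 /eqP.
  by rewrite nth_uniq // => /eqP.
have lt3 w z : w \in s -> z \notin s -> f z w < 3.
  move=> ws zs; have := no3 w z ws; rewrite f_sym ltn_neqAle -ltnS f_lt4 andbT.
  by apply; apply: contraNneq zs => <-.
have [w1s w2s w3s] : [/\ w1 \in s, w2 \in s & w3 \in s] by rewrite !inE !eqxx !orbT.
have f23 : f w2 w3 < 3.
  rewrite ltn_neqAle -ltnS f_lt4 andbT; apply: no3 => //.
  by move: s_uniq; rewrite /= !inE => /and4P[_ _].
have fyx : f y x = 3 by rewrite f_sym.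
have fw1v : f w1 v = 0 by rewrite f_sym.
have fw2v : f w2 v = 1 by rewrite f_sym.
have fw3v : f w3 v = 2 by rewrite f_sym.
(* Positions 0 to 5 stand for v, w1, w2, w3, x, y. The two paths restrict the colour to {0, 1} and
   to {0, 2}; the next three steps are analogous. *)
have fxw1 : f x w1 = 0.
  have := lt3 w1 x w1s xs.
  have := no_path 5 [:: 4; 1; 0; 2] isT; have := no_path 5 [:: 4; 1; 0; 3] isT.
  by rewrite /r /= fyx fw1v fw2 fw3; case: (f x w1) => [|[|[|?]]].
have fxw2 : f x w2 = 1.
  have := lt3 w2 x w2s xs.
  have := no_path 5 [:: 4; 2; 0; 1] isT; have := no_path 5 [:: 4; 2; 0; 3] isT.
  by rewrite /r /= fyx fw2v fw1 fw3; case: (f x w2) => [|[|[|?]]].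
have fyw2 : f y w2 = 1.
  have := lt3 w2 y w2s ys.
  have := no_path 4 [:: 5; 2; 0; 1] isT; have := no_path 4 [:: 5; 2; 0; 3] isT.
  by rewrite /r /= fxy fw2v fw1 fw3; case: (f y w2) => [|[|[|?]]].
have fyw3 : f y w3 = 2.
  have := lt3 w3 y w3s ys.
  have := no_path 4 [:: 5; 3; 0; 1] isT; have := no_path 4 [:: 5; 3; 0; 2] isT.
  by rewrite /r /= fxy fw3v fw1 fw2; case: (f y w3) => [|[|[|?]]].
have := no_path 1 [:: 4; 5; 2; 3] isT; have := no_path 1 [:: 4; 5; 3; 2] isT.
have := no_path 5 [:: 4; 2; 3; 0] isT.
rewrite /r /= (f_sym w1 x) (f_sym w3 w2) fxw1 fxw2 fyw2 fyw3 fxy fyx fw3v.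
by case: (f w2 w3) f23 => [|[|[|?]]].
Qed.

End Claw.

(** * Structure of exact 4-colourings without rainbow P_5 *)

Section Structure.
Variables (T : finType) (g : T -> T -> 'I_4).
Hypothesis g_sym : forall x y, g x y = g y x.
Hypothesis g_norainbow : forall x p,
  uniq (x :: p) -> size p = 4 -> ~~ uniq (pairmap g x p).
Hypothesis g_exact : forall a, exists x y, x != y /\ g x y = a.
Hypothesis T_gt : 4 < #|T|.

(** Taking the [index] in [cols] renames the colours so that the claw gets 0, 1, 2. The set [S] is
    the claw with a fifth vertex: the other end of an edge of colour 3 leaving the claw, or any
    vertex if such an edge lies inside. *)
Lemma claw_monochromatic_complement v w1 w2 w3 :
  uniq [:: v; w1; w2; w3] -> uniq [:: g v w1; g v w2; g v w3] ->
  exists2 S : {set T}, #|S| <= 5 &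
    forall y1 y2 z1 z2, y1 \notin S -> y2 \notin S -> y1 != y2 ->
      z1 \notin S -> z2 \notin S -> z1 != z2 -> g y1 y2 = g z1 z2.
Proof.
set s := [:: v; w1; w2; w3]; set cs := [:: g v w1; g v w2; g v w3] => s_uniq cs_uniq.
pose cols := cs ++ [seq a <- enum 'I_4 | a \notin cs].
have cols_perm : perm_eq cols (enum 'I_4).
  apply: uniq_perm; rewrite ?enum_uniq //.
    rewrite cat_uniq cs_uniq filter_uniq ?enum_uniq // andbT.
    by apply/hasPn => a; rewrite mem_filter => /andP[].
  by move=> a; rewrite mem_cat mem_filter mem_enum andbT orbN.
have cols_size : size cols = 4 by rewrite (perm_size cols_perm) size_enum_ord.
have cols_uniq : uniq cols by rewrite (perm_uniq cols_perm) enum_uniq.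
have cols_all a : a \in cols by rewrite (perm_mem cols_perm) mem_enum.
pose f x y := index (g x y) cols.
have f_sym x y : f x y = f y x by rewrite /f g_sym.
have f_lt4 x y : f x y < 4 by rewrite -cols_size index_mem.
have f_norainbow x p : uniq (x :: p) -> size p = 4 -> ~~ uniq (pairmap f x p).
  move=> xp_uniq szp; apply: contra (g_norainbow xp_uniq szp).
  have -> : pairmap f x p = [seq index a cols | a <- pairmap g x p].
    by elim: (p) x {xp_uniq} => //= y q IHq x; rewrite IHq.
  exact: map_uniq.
have [fw1 fw2 fw3] : [/\ f v w1 = 0, f v w2 = 1 & f v w3 = 2].
  move: cs_uniq; rewrite /f /= !inE negb_or eqxx => /and3P[/andP[n12 n13] n23 _].
  by rewrite (negbTE n12) (negbTE n13) eqxx (negbTE n23) eqxx.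
have [x xs x3] : exists2 x, x \notin s &
    exists a b, [/\ a \in rcons s x, b \in rcons s x, a != b & f a b = 3].
  have [z zs] : exists z, z \notin s.
    apply/existsP; apply: contraTT T_gt => /existsPn all_s.
    rewrite -leqNgt -[4]/(size s); apply: leq_trans (card_size s).
    by apply/subset_leq_card/subsetP => z _; have := all_s z; rewrite negbK.
  have [/existsP[a /existsP[b /and3P[sa nab /eqP fab]]]|no3] :=
    boolP [exists a, exists b, [&& a \in s, a != b & f a b == 3]].
    have [bs|bs] := boolP (b \in s); [exists z | exists b]; rewrite ?bs //;
      by exists a, b; rewrite !mem_rcons ![_ \in _ :: s]in_cons sa ?bs ?eqxx ?orbT.
  have [x [y [nxy gxy]]] := g_exact (nth ord0 cols 3).
  case: (claw_meets_fourth_color f_sym f_lt4 f_norainbow s_uniq fw1 fw2 fw3 nxy).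
    by rewrite /f gxy index_uniq // cols_size.
  move=> a b sa nab; apply: contra no3 => fab.
  by apply/existsP; exists a; apply/existsP; exists b; apply/and3P.
exists [set u in rcons s x]; first by rewrite cardsE (leq_trans (card_size _)).
move=> y1 y2 z1 z2; rewrite !in_set => y1S y2S ny z1S z2S nz.
have uniq_ext a b : a \notin rcons s x -> b \notin rcons s x -> a != b ->
    uniq ([:: v; w1; w2; w3; x] ++ [:: a; b]).
  move=> aS bS nab; rewrite -[[:: v; _; _; _; _]]/(rcons s x) cat_uniq rcons_uniq xs s_uniq.
  by rewrite [uniq [:: a; b]]/= inE nab /= orbF negb_or aS bS.
have := claw_monochromatic f_sym f_lt4 f_norainbow fw1 fw2 fw3 x3
  (uniq_ext _ _ y1S y2S ny) (uniq_ext _ _ z1S z2S nz).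
by apply: (index_inj ord0); rewrite cols_all.
Qed.

(** The colour of the edge between two vertices is seen by both. An intersecting family of pairs of
    colours is a star or a triangle; a triangle involves only three colours, and exactness excludes
    it. The centre of the star is [d]. *)
Lemma clawfree_dominant_color :
  (forall v w1 w2 w3, uniq [:: v; w1; w2; w3] -> ~~ uniq [:: g v w1; g v w2; g v w3]) ->
  exists d (phi : T -> 'I_4), (forall u, phi u != d) /\
    forall u v, u != v -> g u v != d -> g u v = phi u /\ phi u = phi v.
Proof.
move=> clawfree.
have two_colors v u1 u2 u3 : u1 != v -> u2 != v -> u3 != v ->
    ~~ uniq [:: g v u1; g v u2; g v u3].
  move=> n1 n2 n3; have [/clawfree//|] := boolP (uniq [:: v; u1; u2; u3]).
  rewrite /= !inE !(eq_sym v) (negbTE n1) (negbTE n2) (negbTE n3) /= andbT.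
  by rewrite negb_and !negbK -orbA => /or3P[]/eqP->; rewrite eqxx ?orbT ?andbF.
have [d dP] : exists d, forall v u1 u2, u1 != v -> u2 != v ->
    [|| g v u1 == g v u2, g v u1 == d | g v u2 == d].
  have third_color v u1 u2 u : u1 != v -> u2 != v -> u != v -> g v u1 != g v u2 ->
      g v u = g v u1 \/ g v u = g v u2.
    move=> n1 n2 n nc; have := two_colors v u1 u2 u n1 n2 n.
    rewrite /= !inE (negbTE nc) /= andbT negb_and !negbK.
    by case/orP => /eqP ->; [left | right].
  (* Every vertex sees at most one colour besides [d]; it need not see [d] itself. *)
  pose dominates d := [forall v, forall u1, forall u2, (u1 != v) && (u2 != v) ==>
    [|| g v u1 == g v u2, g v u1 == d | g v u2 == d]].
  suff [d /forallP dP] : exists d, dominates d.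
    exists d => v u1 u2 n1 n2.
    by have /forallP/(_ u1)/forallP/(_ u2)/implyP := dP v; rewrite n1 n2 => /(_ isT).
  have ndominates d : ~~ dominates d -> exists v u1 u2,
      [/\ u1 != v, u2 != v, g v u1 != g v u2, g v u1 != d & g v u2 != d].
    move=> /forallPn[v /forallPn[u1 /forallPn[u2]]].
    rewrite negb_imply !negb_or => /andP[/andP[n1 n2] /and3P[nc nd1 nd2]].
    by exists v, u1, u2.
  (* The choice of [ord0] is arbitrary: its failure supplies a vertex that sees two colours. *)
  have [|/ndominates[v [u1 [u2 [nu1 nu2 nab _ _]]]]] := boolP (dominates ord0).
    by exists ord0.
  (* If neither a nor b dominates, then v, y and z see the pairs {a, b}, {b, e}
     and {a, e}, and an end of an edge of the fourth colour sees three colours. *)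
  set a := g v u1 in nab; set b := g v u2 in nab.
  have [|/ndominates[y [p1 [p2 [np1 np2 np p1a p2a]]]]] := boolP (dominates a).
    by exists a.
  have [|/ndominates[z [q1 [q2 [nq1 nq2 nq q1b q2b]]]]] := boolP (dominates b).
    by exists b.
  have at_v u : u != v -> g v u = a \/ g v u = b by move=> nu; apply: third_color.
  have at_y u : u != y -> g y u != a.
    by move=> nu; case: (third_color y p1 p2 u) => // ->.
  have at_z u : u != z -> g z u != b.
    by move=> nu; case: (third_color z q1 q2 u) => // ->.
  have nyv : y != v.
    apply: contraNneq np => yv; move: np1 np2 p1a p2a; rewrite yv => np1 np2.
    by case: (at_v p1 np1) => ->; case: (at_v p2 np2) => ->; rewrite eqxx.
  have nzv : z != v.
    apply: contraNneq nq => zv; move: nq1 nq2 q1b q2b; rewrite zv => nq1 nq2.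
    by case: (at_v q1 nq1) => ->; case: (at_v q2 nq2) => ->; rewrite eqxx.
  have gyv : g y v = b.
    by case: (at_v y nyv) (at_y v); rewrite eq_sym nyv g_sym // => -> /(_ isT); rewrite eqxx.
  have gzv : g z v = a.
    by case: (at_v z nzv) (at_z v); rewrite eq_sym nzv g_sym // => -> /(_ isT); rewrite eqxx.
  have nyz : y != z by apply: contraNneq nab => yz; rewrite -gyv -gzv yz.
  set e := g y z.
  have nea : e != a by apply: at_y; rewrite eq_sym.
  have neb : e != b by rewrite /e g_sym; apply: at_z.
  have at_y' u : u != y -> g y u = b \/ g y u = e.
    by move=> nu; rewrite -gyv; apply: third_color; rewrite // 1?eq_sym ?gyv // eq_sym.
  have at_z' u : u != z -> g z u = a \/ g z u = e.
    by move=> nu; rewrite -gzv /e (g_sym y); apply: third_color; rewrite // 1?eq_sym // gzv g_sym.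
  have [r] : exists r, r \notin [:: a; b; e].
    apply/existsP; apply: contraTT (leqnn 4) => /existsPn all_s.
    rewrite -ltnNge ltnS -[X in X <= _]card_ord -[3]/(size [:: a; b; e]).
    apply: leq_trans (card_size _).
    by apply/subset_leq_card/subsetP => c _; have := all_s c; rewrite negbK.
  rewrite !inE !negb_or => /and3P[nra nrb nre].
  have [m [m' [nm gm]]] := g_exact r.
  have nmv : m != v.
    apply/eqP => mv; case: (at_v m'); rewrite -?mv 1?eq_sym // gm => /eqP; exact/negP.
  have nmy : m != y.
    apply/eqP => mv; case: (at_y' m'); rewrite -?mv 1?eq_sym // gm => /eqP; exact/negP.
  have nmz : m != z.
    apply/eqP => mv; case: (at_z' m'); rewrite -?mv 1?eq_sym // gm => /eqP; exact/negP.
  (* Besides [r], the vertex [m] sees at most one colour, so its edges to v, y and z agree. Their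
     common colour would lie in {a, b}, {b, e} and {a, e} at once. *)
  have gm_eq u w : u != m -> w != m -> g u m != r -> g w m != r -> g u m = g w m.
    move=> nu nw; rewrite !(g_sym _ m) -gm => gu gw; apply/eqP/negPn/negP => guw.
    case: (third_color m u w m') => //; rewrite 1?eq_sym // => /eqP; apply/negP; by rewrite eq_sym.
  have gvm : g v m != r by case: (at_v m nmv) => ->; rewrite eq_sym.
  have gym : g y m != r by case: (at_y' m nmy) => ->; rewrite eq_sym.
  have gzm : g z m != r by case: (at_z' m nmz) => ->; rewrite eq_sym.
  have vy : g v m = g y m by apply: gm_eq; rewrite // eq_sym.
  have vz : g v m = g z m by apply: gm_eq; rewrite // eq_sym.
  case: (at_v m nmv) (at_y' m nmy) (at_z' m nmz); rewrite -vy -vz => ->.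
    by case=> /eqP; [rewrite (negbTE nab) | rewrite eq_sym (negbTE nea)].
  by move=> _ [] /eqP; [rewrite eq_sym (negbTE nab) | rewrite eq_sym (negbTE neb)].
(* A vertex that sees only [d] is put into an arbitrary part. *)
pose phi v := if [pick u | (u != v) && (g v u != d)] is Some u then g v u else
  if d == ord0 then ord_max else ord0.
have phi_d u : phi u != d.
  rewrite /phi; case: pickP => [v /andP[]//|_].
  by case: (d =P ord0) => [->|/eqP]; rewrite // eq_sym.
have phiE u v : v != u -> g u v != d -> g u v = phi u.
  rewrite /phi => nvu nd; case: pickP => [w /andP[nwu nwd]|/(_ v)]; last by rewrite nvu nd.
  by have := dP u v w nvu nwu; rewrite (negbTE nd) (negbTE nwd) !orbF => /eqP.
exists d, phi; split => // u v nuv nd; split; first by rewrite phiE // eq_sym.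
have nvu : v != u by rewrite eq_sym.
by rewrite -(phiE u v) // -(phiE v u) // g_sym.
Qed.

End Structure.

(** * Building copies of the path and of the pineapple *)

Section Copies.
Variables (n k : nat) (c : edge_coloring (complete_graph n) k).

Lemma rainbow_path_copy (x : 'I_n) (p : seq 'I_n) :
  uniq (x :: p) -> uniq (pairmap (fun u v => c [set u; v]) x p) ->
  has_rainbow (path_graph (size p).+1) c.
Proof.
set g := fun u v => c [set u; v] => xp_uniq col_uniq.
pose h (i : path_graph (size p).+1) : complete_graph n := nth x (x :: p) i.
have h_inj : injective h.
  move=> i j /eqP; rewrite nth_uniq ?ltn_ord // => /eqP; exact: val_inj.
exists h; first by split=> // i j ij; rewrite /= /complete_rel (inj_eq h_inj);
  apply: contraTneq ij => ->; rewrite adj_irr.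
have edgeE e : e \in edges (path_graph (size p).+1) ->
    exists i j : 'I_(size p).+1, [/\ j = i.+1 :> nat, e = [set i; j] &
      c (h @: e) = nth (g x x) (pairmap g x p) i].
  case/imsetP => -[i j]; rewrite inE /= /path_rel => ij ->.
  have ijE (a b : 'I_(size p).+1) : b = a.+1 :> nat ->
      c (h @: [set a; b]) = nth (g x x) (pairmap g x p) a.
    move=> ba; have a_lt : a < size p by rewrite -ltnS -ba ltn_ord.
    by rewrite imsetU1 imset_set1 (nth_pairmap x) // /g /h ba.
  case/orP: ij => /eqP ij; first by exists i, j; split; rewrite // ijE.
  by exists j, i; rewrite /= setUC; split; rewrite // ijE.
have lt_size (i j : 'I_(size p).+1) : j = i.+1 :> nat -> i < size (pairmap g x p).
  by move=> ij; have := ltn_ord j; rewrite size_pairmap ij.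
move=> e1 e2 /edgeE[i1 [j1 [ij1 def_e1 ->]]] /edgeE[i2 [j2 [ij2 def_e2 ->]]] /eqP.
rewrite (nth_uniq _ (lt_size _ _ ij1) (lt_size _ _ ij2) col_uniq) => /eqP i12.
rewrite def_e1 def_e2 (val_inj i12); congr (_ |: [set _]); apply: val_inj.
by rewrite /= ij1 ij2 i12.
Qed.

Definition color_nbhd (a : 'I_k) (x : 'I_n) := [set y | (y != x) && (c [set x; y] == a)].

Definition color_clique (a : 'I_k) (K : {set 'I_n}) :=
  [forall y in K, forall z in K, (y != z) ==> (c [set y; z] == a)].

Lemma color_cliqueP a (K : {set 'I_n}) :
  reflect {in K &, forall y z, y != z -> c [set y; z] = a} (color_clique a K).
Proof.
apply: (iffP forall_inP) => [Ka y z yK zK nyz | Ka y yK].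
  by have /forall_inP/(_ z zK)/implyP/(_ nyz)/eqP := Ka y yK.
by apply/forall_inP => z zK; apply/implyP => nyz; rewrite Ka.
Qed.

(** List x, then the rest of K, then the remaining neighbours of x in colour a. The first w entries
    lie in K, and every entry after x, in K or not, can serve as a pendent vertex. *)
Lemma pineapple_copy t w a x (K : {set 'I_n}) :
  0 < w -> x \in K -> w <= #|K| -> color_clique a K ->
  t <= #|color_nbhd a x|.+1 -> has_monochromatic (pineapple t w) c.
Proof.
set N := color_nbhd a x => w_gt0 xK wK /color_cliqueP Ka tN.
have KN : K :\ x \subset N.
  by apply/subsetP => y; rewrite !inE => /andP[nyx yK]; rewrite nyx Ka //= eq_sym.
pose s := enum (K :\ x) ++ enum (N :\: K).
have xs_uniq : uniq (x :: s).
  rewrite /= mem_cat !mem_enum !inE eqxx andbF cat_uniq !enum_uniq andbT /=.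
  by apply/hasPn => y; rewrite !mem_enum !inE => /andP[/negbTE -> _]; rewrite andbF.
have sN y : y \in s -> y \in N.
  by rewrite mem_cat !mem_enum => /orP[/(subsetP KN)|/setDP[]].
have s_size : t <= size (x :: s).
  rewrite /= size_cat -!cardE; apply: leq_trans tN _; rewrite ltnS.
  rewrite -(cardsID K N) leq_add2r subset_leq_card //.
  by apply/subsetP => y; rewrite !inE => /andP[/andP[-> _] ->].
pose h (i : pineapple t w) : complete_graph n := nth x (x :: s) i.
have h_lt (i : 'I_t) : i < size (x :: s) by apply: leq_trans s_size.
have h_inj : injective h.
  move=> i j /eqP; rewrite nth_uniq ?h_lt // => /eqP; exact: val_inj.
have hK (i : 'I_t) : i < w -> h i \in K.
  rewrite /h; case: (nat_of_ord i) => [//|m] mw /=.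
  have m_lt : m < size (enum (K :\ x)).
    by rewrite -cardE; have := cardsD1 x K; rewrite xK; lia.
  by rewrite nth_cat m_lt; have := mem_nth x m_lt; rewrite mem_enum !inE => /andP[].
have h0 (i j : 'I_t) : i = 0 :> nat -> w <= j -> c [set h i; h j] = a.
  move=> i0 wj; rewrite {1}/h i0 /=; have : h j \in N.
    apply: sN; move: (h_lt j) (leq_trans w_gt0 wj).
    by rewrite /h; case: (nat_of_ord j) => // m m_lt _; apply: mem_nth.
  by rewrite inE => /andP[_ /eqP].
exists h.
  split=> // i j ij; rewrite /= /complete_rel (inj_eq h_inj).
  by apply: contraTneq ij => ->; rewrite adj_irr.
exists a => e /imsetP[[i j]]; rewrite inE /= => /andP[nij ij] ->.
rewrite imsetU1 imset_set1; case/or3P: ij => [/andP[iw jw]|/andP[/eqP i0 wj]|/andP[/eqP j0 wi]].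
- by apply: Ka; rewrite ?hK // (inj_eq h_inj).
- exact: h0.
- by rewrite setUC h0.
Qed.

End Copies.

(* The Ramsey bound R(3, k) <= 'C(k + 1, 2). *)
Lemma triangle_free_independent (T : finType) (r : rel T) k (A : {set T}) :
  symmetric r ->
  {in A & &, forall x y z, x != y -> y != z -> x != z -> ~~ [&& r x y, r y z & r x z]} ->
  'C(k.+1, 2) <= #|A| ->
  exists2 K : {set T}, K \subset A & k <= #|K| /\ {in K &, forall y z, y != z -> ~~ r y z}.
Proof.
move=> r_sym; elim: k A => [|k IHk] A no_tri A_size.
  by exists set0; rewrite ?sub0set //; split=> // y z; rewrite inE.
have [v vA] : exists v, v \in A.
  by apply/card_gt0P; apply: leq_trans A_size; rewrite bin_gt0.
pose D := [set y in A | (y != v) && r v y].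
pose B := [set y in A | (y != v) && ~~ r v y].
have A_card : #|A| = (#|D| + #|B|).+1.
  rewrite (cardsD1 v) vA -(cardsID [set y | r v y]) add1n; congr (_ + _).+1.
    by apply: eq_card => y; rewrite !inE andbCA andbA.
  by apply: eq_card => y; rewrite !inE andbC -andbA andbCA.
(* The neighbours [D] of v are independent, as there is no triangle. If there are at most k of them,
   the non-neighbours [B] are numerous enough for induction, and v is added to the set found
   there. *)
have [D_size|D_size] := leqP k.+1 #|D|.
  exists D; first by apply/subsetP => y; rewrite inE => /andP[].
  split=> // y z; rewrite !inE => /and3P[yA nyv vy] /and3P[zA nzv vz] nyz.
  have := no_tri v y z vA yA zA; rewrite eq_sym nyv nyz (eq_sym v) nzv.
  by rewrite vy vz andbT => /(_ isT isT isT).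
have BA : B \subset A by apply/subsetP => y; rewrite inE => /andP[].
have [] := IHk B.
- move=> x y z xB yB zB; exact: no_tri (subsetP BA _ xB) (subsetP BA _ yB) (subsetP BA _ zB).
- by move: A_size; rewrite binS bin1 A_card; lia.
move=> K KB [K_size Kr].
have vK : v \notin K by apply: contraL vA => /(subsetP KB); rewrite inE eqxx andbF.
have vKr y : y \in K -> ~~ r v y by move/(subsetP KB); rewrite inE => /and3P[].
exists (v |: K); first by rewrite subUset sub1set vA (subset_trans KB).
split=> [|y z]; first by rewrite cardsU1 vK.
rewrite !inE => /predU1P[->|yK] /predU1P[->|zK]; rewrite ?eqxx //.
- by move=> _; apply: vKr.
- by move=> _; rewrite r_sym; apply: vKr.
- exact: Kr.
Qed.

(** * The case of a dominant colour *)

Section DominantColor.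
Variables (n t : nat) (c : edge_coloring (complete_graph n) 4).
Variables (d : 'I_4) (phi : 'I_n -> 'I_4).
Local Notation g := (fun u v : 'I_n => c [set u; v]).
Hypothesis phi_d : forall u, phi u != d.
Hypothesis gP : forall u v, u != v -> g u v != d -> g u v = phi u /\ phi u = phi v.
Hypothesis c_exact : exact c.
Hypotheses (t_ge8 : 8 <= t) (n_ge : 4 * t - 3 <= n).
Hypothesis no_pineapple : forall a x (K : {set 'I_n}),
  x \in K -> 5 <= #|K| -> color_clique c a K -> #|color_nbhd c a x|.+1 < t.

Let part i := [set u | phi u == i].

Lemma color_clique_lt a (K : {set 'I_n}) : color_clique c a K -> #|K| < t.
Proof.
move=> Ka; rewrite ltnNge; apply/negP => tK.
have [x xK] : exists x, x \in K by apply/card_gt0P; lia.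
have K5 : 5 <= #|K| by lia.
have := no_pineapple xK K5 Ka; rewrite ltnNge => /negP; apply.
apply: leq_trans tK _; rewrite (cardsD1 x) xK ltnS subset_leq_card //.
apply/subsetP => y; rewrite !inE => /andP[nyx yK]; rewrite nyx /=.
by move/color_cliqueP: Ka => ->; rewrite // eq_sym.
Qed.

Lemma dominant_between u v : phi u != phi v -> g u v = d.
Proof.
move=> nuv; apply/eqP/negPn/negP => /gP[|_]; last exact/eqP.
by apply: contraNneq nuv => ->.
Qed.

Lemma dominant_within i u v :
  u \in part i -> u != v -> g u v != d -> g u v = i.
Proof. by rewrite inE => /eqP <- nuv /(gP nuv)[]. Qed.

Lemma part_inhabited i : i != d -> exists u, u \in part i.
Proof.
move=> nid; have [_ /imsetP[[u v] uv ->] /= cuv] := c_exact i.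
exists u; rewrite inE; move: uv; rewrite inE /= /complete_rel => /gP.
by rewrite /= cuv => /(_ nid)[-> _].
Qed.

Lemma card_parts i j k :
  uniq [:: d; i; j; k] -> #|part i| + #|part j| + #|part k| = n.
Proof.
move=> dijk_uniq.
have all4 a : a \in [:: d; i; j; k].
  apply: contraT => na; have := max_card [in [:: a; d; i; j; k]].
  by rewrite (card_uniqP _) ?card_ord //= na.
transitivity #|part i :|: part j :|: part k|; last first.
  rewrite -[RHS]card_ord -cardsT; apply: eq_card => u; rewrite !inE.
  by have := all4 (phi u); rewrite !inE (negbTE (phi_d u)) -orbA.
move: dijk_uniq; rewrite /= !inE !negb_or => /and4P[_ /andP[nij nik] njk _].
rewrite !cardsU.
have -> : part i :&: part j = set0.
  by apply/setP => u; rewrite !inE; case: eqP => // ->; apply: negbTE.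
have -> : (part i :|: part j) :&: part k = set0.
  by apply/setP => u; rewrite !inE; case: (phi u =P k) => [->|_]; rewrite ?andbF // andbT
    !(eq_sym k) (negbTE nik) (negbTE njk).
by rewrite !cards0 !subn0.
Qed.

(** All vertices outside the part of y are joined to y in colour d. As y lies in a K_5 of that
    colour, there can be at most t - 2 of them. *)
Lemma no_dominant_five_clique (s : seq 'I_n) y :
  uniq s -> y \in s -> 5 <= size s -> pairwise (fun u v => g u v == d) s ->
  n.+1 < #|part (phi y)| + t.
Proof.
move=> s_uniq ys s5 s_d.
have clique_s : color_clique c d [set u in s].
  apply/color_cliqueP => u v; rewrite !inE {s_uniq ys s5}.
  elim: s s_d => //= a s IHs /andP[/allP sa s_d].
  rewrite !inE => /predU1P[->|us] /predU1P[->|vs]; rewrite ?eqxx //.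
  - by move/sa: vs => /eqP.
  - by move/sa: us => /eqP; rewrite setUC.
  - exact: IHs.
have := no_pineapple (a := d) (x := y) (K := [set u in s]).
rewrite inE ys cardsE (card_uniqP s_uniq) => /(_ isT s5 clique_s).
have : #|~: part (phi y)| <= #|color_nbhd c d y|.
  apply/subset_leq_card/subsetP => u; rewrite !inE => nuy.
  by rewrite dominant_between 1?eq_sym // eqxx andbT; apply: contraNneq nuy => ->.
have := cardsC (part (phi y)); rewrite card_ord; lia.
Qed.

(** One vertex from each other part completes a triangle of colour d to a K_5. The bound at these
    two vertices makes parts j and k both larger than n - t + 1, whence n < 2t. *)
Lemma part_triangle_free i j k : uniq [:: d; i; j; k] ->
  {in part i & &, forall x y z, x != y -> y != z -> x != z ->
     ~~ [&& g x y == d, g y z == d & g x z == d]}.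
Proof.
move=> dijk x y z; rewrite !inE => /eqP xi /eqP yi /eqP zi nxy nyz nxz.
apply/negP => /and3P[xy_d yz_d xz_d].
have parts := card_parts dijk.
move: dijk; rewrite /= !inE !negb_or => /and4P[/and3P[ndi ndj ndk] /andP[nij nik] njk _].
have [v] : exists v, v \in part j by apply: part_inhabited; rewrite eq_sym.
have [w] : exists w, w \in part k by apply: part_inhabited; rewrite eq_sym.
rewrite !inE => /eqP wk /eqP vj.
have s_uniq : uniq [:: v; w; x; y; z].
  have neq a b : phi a != phi b -> a != b by apply: contraNneq => ->.
  by rewrite /= !inE !negb_or nxy nyz nxz !neq // ?xi ?yi ?zi ?wk ?vj // eq_sym.
have s_d : pairwise (fun u v => g u v == d) [:: v; w; x; y; z].
  rewrite /= xy_d yz_d xz_d.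
  by rewrite !dominant_between ?eqxx // ?xi ?yi ?zi ?wk ?vj // eq_sym.
have := no_dominant_five_clique (y := v) s_uniq; have := no_dominant_five_clique (y := w) s_uniq.
rewrite !inE !eqxx ?orbT => /(_ isT isT s_d) + /(_ isT isT s_d).
rewrite wk vj; move: parts n_ge t_ge8; clear; lia.
Qed.

Lemma part_card_le i j k : uniq [:: d; i; j; k] -> #|part i| <= 2 * t - 2.
Proof.
move=> dijk; have no_tri := part_triangle_free dijk.
have nid : i != d by move: dijk; rewrite eq_sym /= inE negb_or => /and3P[/andP[]].
rewrite leqNgt; apply/negP => part_gt.
have [|||K Ki [K5 Kd]] := triangle_free_independent (k := 5) (A := part i)
  (r := fun u v => g u v == d).
- by move=> u v; rewrite setUC.
- exact: no_tri.
(* Here 15 is 'C(6, 2), and 2t - 1 >= 15 because t >= 8. *)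
- by rewrite (leq_trans (_ : _ <= 15)) //; lia.
have Ka : color_clique c i K.
  apply/color_cliqueP => u v uK vK nuv.
  by apply: dominant_within; rewrite ?(subsetP Ki) // Kd.
have [x xK] : exists x, x \in K by apply/card_gt0P; lia.
have xi := subsetP Ki x xK.
(* Without triangles of colour d, [D] is a clique of colour i, so it has at most t - 1 vertices. As
   x lies in [K], it has at most t - 2 neighbours in colour i. Counting x itself gives 2t - 2. *)
pose D := [set u in part i | (u != x) && (g x u == d)].
have D_lt : #|D| < t.
  apply: (@color_clique_lt i); apply/color_cliqueP => u v.
  rewrite !inE => /and3P[ui nux /eqP xu_d] /and3P[vi nvx /eqP xv_d] nuv.
  apply: dominant_within; rewrite ?inE //.
  apply/negP => uv_d; have := no_tri x u v xi; rewrite !inE ui vi xu_d xv_d uv_d eqxx nuv.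
  by rewrite eq_sym nux eq_sym nvx => /(_ isT isT isT isT isT).
have := no_pineapple xK K5 Ka.
have : #|part i| <= #|D| + #|color_nbhd c i x|.+1.
  rewrite (cardsD1 x) xi -(cardsID [set u | g x u == d]) add1n addnS ltnS.
  apply: leq_add; apply: subset_leq_card; apply/subsetP => u; rewrite !inE.
    by case/andP => /andP[-> ->].
  case/and3P => nd nux ui; rewrite nux (dominant_within xi) ?eqxx //.
  by rewrite eq_sym.
lia.
Qed.

(** A part without edges of colour d is a clique. If both parts had such an edge, the two edges and
    a vertex of part k would form a K_5 of colour d, and part i would have more than n + 1 - t >= 3t
    - 2 vertices. *)
Lemma part_clique_or i j k : uniq [:: d; i; j; k] -> #|part i| < t \/ #|part j| < t.
Proof.
move=> dijk.
have part_clique l : color_clique c l (part l) \/ exists x y,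
    [/\ x \in part l, y \in part l, x != y & g x y = d].
  have [|/forall_inPn[x xl /forall_inPn[y yl]]] := boolP (color_clique c l (part l)); first by left.
  rewrite negb_imply => /andP[nxy xy_l]; right; exists x, y; split=> //.
  by apply/eqP; apply: contraNT xy_l => xy_d; rewrite (dominant_within xl).
have parts := card_parts dijk; have i_le := part_card_le dijk.
have [/color_clique_lt|[x1 [x2 [x1i x2i nx x12]]]] := part_clique i; first by left.
have [/color_clique_lt|[y1 [y2 [y1j y2j ny y12]]]] := part_clique j; first by right.
move: dijk; rewrite /= !inE !negb_or => /and4P[/and3P[ndi ndj ndk] /andP[nij nik] njk _].
have [z] : exists z, z \in part k by apply: part_inhabited; rewrite eq_sym.
move: x1i x2i y1j y2j; rewrite !inE => /eqP x1i /eqP x2i /eqP y1j /eqP y2j /eqP zk.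
have s_uniq : uniq [:: x1; x2; y1; y2; z].
  have neq a b : phi a != phi b -> a != b by apply: contraNneq => ->.
  by rewrite /= !inE !negb_or nx ny !neq // ?x1i ?x2i ?y1j ?y2j ?zk // eq_sym.
have s_d : pairwise (fun u v => g u v == d) [:: x1; x2; y1; y2; z].
  rewrite /= x12 y12.
  by rewrite !dominant_between ?eqxx // ?x1i ?x2i ?y1j ?y2j ?zk // eq_sym.
have := no_dominant_five_clique (y := x1) s_uniq.
rewrite inE eqxx => /(_ isT isT s_d); rewrite x1i.
by move: parts i_le n_ge t_ge8; clear; lia.
Qed.

Lemma dominant_color_absurd : False.
Proof.
have [i [j [k dijk]]] : exists i j k, uniq [:: d; i; j; k].
  have := cardC1 d; rewrite card_ord cardE; have := enum_uniq (predC1 d).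
  have : d \notin enum (predC1 d) by rewrite mem_enum inE eqxx.
  case: (enum _) => [|i [|j [|k []]]] // d_notin ijk_uniq _.
  by exists i, j, k; rewrite cons_uniq d_notin.
have perm_d s : perm_eq [:: d; i; j; k] s -> uniq s by move/perm_uniq <-.
have dikj : uniq [:: d; i; k; j] by apply/perm_d/permP => a /=; lia.
have djki : uniq [:: d; j; k; i] by apply/perm_d/permP => a /=; lia.
have dkij : uniq [:: d; k; i; j] by apply/perm_d/permP => a /=; lia.
have parts := card_parts dijk.
have [i_le j_le k_le] := And3 (part_card_le dijk) (part_card_le djki) (part_card_le dkij).
(* The three pairs leave at most one part with t or more vertices. *)
have := part_clique_or dijk; have := part_clique_or djki; have := part_clique_or dikj.
move: parts i_le j_le k_le n_ge t_ge8; clear; lia.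
Qed.

End DominantColor.

(** * Upper bound: combining the two cases *)

Lemma gallai_ramsey_upper t n (c : edge_coloring (complete_graph n) 4) :
  8 <= t -> 4 * t - 3 <= n -> exact c ->
  has_rainbow (path_graph 5) c \/ has_monochromatic (pineapple t 5) c.
Proof.
move=> t_ge8 n_ge c_exact; pose g (u v : 'I_n) := c [set u; v].
have [/existsP[x /existsP[p /andP[xp_uniq col_uniq]]]|no_path] :=
    boolP [exists x, exists p : 4.-tuple 'I_n, uniq (x :: p) && uniq (pairmap g x p)].
  by left; have := rainbow_path_copy xp_uniq col_uniq; rewrite size_tuple.
have [/existsP[a /existsP[x /existsP[K /and4P[xK K5 Ka tN]]]]|no_pineapple] :=
    boolP [exists a, exists x, exists K : {set 'I_n}, [&& x \in K, 5 <= #|K|,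
      color_clique c a K & t <= #|color_nbhd c a x|.+1]].
  by right; apply: pineapple_copy xK K5 Ka tN.
have {}no_pineapple a x (K : {set 'I_n}) : x \in K -> 5 <= #|K| -> color_clique c a K ->
    #|color_nbhd c a x|.+1 < t.
  move=> xK K5 Ka; rewrite ltnNge; apply: contra no_pineapple => tN.
  by apply/existsP; exists a; apply/existsP; exists x; apply/existsP; exists K; apply/and4P.
have g_sym x y : g x y = g y x by rewrite /g setUC.
have g_norainbow x p : uniq (x :: p) -> size p = 4 -> ~~ uniq (pairmap g x p).
  move=> xp_uniq /eqP szp; apply: contra no_path => col_uniq.
  by apply/existsP; exists x; apply/existsP; exists (Tuple szp); rewrite xp_uniq.
have g_exact a : exists x y, x != y /\ g x y = a.
  by have [_ /imsetP[[x y]] + ->] := c_exact a; rewrite inE /= => nxy <-; exists x, y.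
have n_gt4 : 4 < #|'I_n| by rewrite card_ord; lia.
exfalso; have [/existsP[v /existsP[w1 /existsP[w2 /existsP[w3 /andP[]]]]]|clawfree] :=
    boolP [exists v, exists w1, exists w2, exists w3,
      uniq [:: v; w1; w2; w3] && uniq [:: g v w1; g v w2; g v w3]].
  move=> v_uniq col_uniq.
  have [S S5 S_mono] := claw_monochromatic_complement
    g_sym g_norainbow g_exact n_gt4 v_uniq col_uniq.
  have S_card := cardsC S; rewrite card_ord in S_card.
  (* This pair only names the colour of the clique outside [S]. *)
  have [y1 [y2 [y1S y2S ny]]] : exists y1 y2, [/\ y1 \notin S, y2 \notin S & y1 != y2].
    have /card_gt1P[y1 [y2 []]] : 1 < #|~: S| by lia.
    by rewrite !inE => ? ? ?; exists y1, y2.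
  suff : #|~: S| < t by lia.
  apply: (color_clique_lt t_ge8 n_ge no_pineapple (a := g y1 y2)).
  by apply/color_cliqueP => z1 z2; rewrite !inE => z1S z2S nz; apply: S_mono.
have [|d [phi [phi_d gP]]] := clawfree_dominant_color g_sym g_exact.
  move=> v w1 w2 w3 v_uniq; apply: contra clawfree => col_uniq.
  apply/existsP; exists v; apply/existsP; exists w1; apply/existsP; exists w2.
  by apply/existsP; exists w3; apply/andP.
exact: dominant_color_absurd phi_d gP c_exact t_ge8 n_ge no_pineapple.
Qed.

(** * Lower bound: a colouring with four blocks *)

Section LowerBound.
Variables (t n : nat).
Hypotheses (t_ge5 : 5 <= t) (n_eq : n = 4 * (t - 1)).

Let block (v : 'I_n) := v %/ (t - 1).
(** There are only four blocks, so the default 0 of [nth] is never reached. *)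
Let block_color b : 'I_4 := inord (nth 0 [:: 1; 2; 3; 1] b).

(** Colourings are functions of sets, so the block is read off an arbitrary element; for equal
    blocks the choice does not matter. *)
Definition block_coloring : edge_coloring (complete_graph n) 4 := fun e =>
  if [pick u in e] is Some u then
    if [forall v in e, block v == block u] then block_color (block u) else ord0
  else ord0.

Lemma block_coloringE u v : block_coloring [set u; v] =
  if block u == block v then block_color (block u) else ord0.
Proof.
rewrite /block_coloring; case: pickP => [w|/(_ u)]; last by rewrite !inE eqxx.
rewrite !inE => uvw; have -> : [forall x in [set u; v], block x == block w] = (block u == block v).
  apply/forall_inP/eqP => [b_w|b_uv x].
    by rewrite (eqP (b_w u _)) ?(eqP (b_w v _)) // !inE eqxx ?orbT.
  by rewrite !inE; case/orP: uvw => /eqP-> /orP[]/eqP->; rewrite ?b_uv.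
by case: eqP => // b_uv; case/orP: uvw => /eqP->; rewrite ?b_uv.
Qed.

Lemma block_lt4 v : block v < 4.
Proof. by rewrite /block ltn_divLR; have := ltn_ord v; lia. Qed.

Lemma block_color_neq0 v : block_color (block v) != ord0.
Proof.
rewrite -val_eqE /= inordK; have := block_lt4 v.
  by case: (block v) => [|[|[|[|]]]].
by case: (block v) => [|[|[|[|]]]].
Qed.

Lemma block_coloring_exact : exact block_coloring.
Proof.
have edge u v (lu : u < n) (lv : v < n) : u < v ->
    [set Ordinal lu; Ordinal lv] \in edges (complete_graph n).
  move=> uv; apply/imsetP; exists (Ordinal lu, Ordinal lv) => //.
  by rewrite inE /= /complete_rel -val_eqE /= neq_ltn uv.
have same_block b : b < 3 -> exists2 e, e \in edges (complete_graph n) &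
    block_coloring e = block_color b.
  move=> b3; have lu : b * (t - 1) < n by nia.
  have lv : b * (t - 1) + 1 < n by nia.
  exists [set Ordinal lu; Ordinal lv]; first by apply: edge; lia.
  rewrite block_coloringE /block /= mulnK ?divnMDl ?(@divn_small 1) ?addn0 ?eqxx //; lia.
case=> [[|[|[|[|//]]]] a4].
- have lu : 0 < n by lia.
  have lv : t - 1 < n by lia.
  exists [set Ordinal lu; Ordinal lv]; first by apply: edge; lia.
  rewrite block_coloringE /block /= div0n divnn (_ : 0 < t - 1); last by lia.
  exact: val_inj.
- have [e eE e_color] := same_block 0 isT; exists e => //.
  by rewrite e_color; apply: val_inj; rewrite /= inordK.
- have [e eE e_color] := same_block 1 isT; exists e => //.
  by rewrite e_color; apply: val_inj; rewrite /= inordK.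
- have [e eE e_color] := same_block 2 isT; exists e => //.
  by rewrite e_color; apply: val_inj; rewrite /= inordK.
Qed.

(** At most one edge of a rainbow path joins different blocks, since all such edges have colour 0.
    Of the at least three other edges among four, two are consecutive; they lie in one block and
    share its colour. *)
Lemma block_coloring_no_rainbow : ~ has_rainbow (path_graph 5) block_coloring.
Proof.
case=> f _ f_rainbow.
pose e i : {set 'I_5} := [set inord i; inord i.+1].
have eE i : i < 4 -> e i \in edges (path_graph 5).
  move=> i4; apply/imsetP; exists (inord i, inord i.+1) => //.
  by rewrite inE /= /path_rel !inordK ?eqxx // ltnW.
pose b i := block (f (inord i)).
have ce i : block_coloring (f @: e i) = if b i == b i.+1 then block_color (b i) else ord0.
  by rewrite imsetU1 imset_set1 block_coloringE.
have e_inj i j : i < 4 -> j < 4 -> e i = e j -> i = j.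
  move=> i4 j4 /setP eij.
  have := eij (inord i); have := eij (inord i.+1); have := eij (inord j).
  rewrite !inE -!val_eqE /= !inordK //; lia.
have no_zeros i j : i < j -> j < 4 -> b i != b i.+1 -> b j != b j.+1 -> False.
  move=> ij j4 ni nj; have i4 := ltn_trans ij j4.
  suff /e_inj : e i = e j by move=> /(_ i4 j4) eq_ij; rewrite eq_ij ltnn in ij.
  by apply: f_rainbow; rewrite ?eE // !ce (negbTE ni) (negbTE nj).
have no_consecutive i : i < 3 -> b i = b i.+1 -> b i.+1 = b i.+2 -> False.
  move=> i3 bi bi1; suff /e_inj : e i = e i.+1.
    by move=> /(_ (ltnW i3) i3) /eqP; rewrite ltn_eqF.
  by apply: f_rainbow; rewrite ?eE ?ce ?bi -?bi1 ?eqxx // ltnW.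
have [b01|b01] := eqVneq (b 0) (b 1).
  have [b12|b12] := eqVneq (b 1) (b 2); first exact: (no_consecutive 0).
  have [b23|b23] := eqVneq (b 2) (b 3); last exact: (no_zeros 1 2).
  have [b34|b34] := eqVneq (b 3) (b 4); last exact: (no_zeros 1 3).
  exact: (no_consecutive 2).
have [b12|b12] := eqVneq (b 1) (b 2); last exact: (no_zeros 0 1).
have [b23|b23] := eqVneq (b 2) (b 3); last exact: (no_zeros 0 2).
exact: (no_consecutive 1).
Qed.

(** In colour 0, the five clique vertices would need five different blocks. In any other colour, all
    t vertices would lie in the block of the centre, which has t - 1 vertices. *)
Lemma block_coloring_no_monochromatic : ~ has_monochromatic (pineapple t 5) block_coloring.
Proof.
case=> f [f_inj _] [a f_mono].
have colorE (i j : 'I_t) : pineapple_rel 5 i j ->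
    a = if block (f i) == block (f j) then block_color (block (f i)) else ord0.
  move=> ij; have := f_mono [set i; j]; rewrite imsetU1 imset_set1 block_coloringE => -> //.
  by apply/imsetP; exists (i, j); rewrite ?inE.
have [a0|a_neq0] := eqVneq a ord0.
  pose h (i : 'I_5) : 'I_4 := Ordinal (block_lt4 (f (widen_ord t_ge5 i))).
  suff /leq_card : injective h by rewrite !card_ord.
  move=> i j /(congr1 val) /= hij; apply/eqP/negPn/negP => nij.
  have /colorE : pineapple_rel 5 (widen_ord t_ge5 i) (widen_ord t_ge5 j).
    by rewrite /pineapple_rel -val_eqE /= nij !ltn_ord.
  by rewrite hij eqxx a0 => /esym/eqP; apply/negP/block_color_neq0.
have t_gt0 : 0 < t by lia.
have same_block (i : 'I_t) : block (f i) = block (f (Ordinal t_gt0)).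
  have [->//|ni0] := eqVneq i (Ordinal t_gt0).
  have /colorE : pineapple_rel 5 i (Ordinal t_gt0).
    by rewrite /pineapple_rel ni0 /= andbT !andbF /=; case: ltnP.
  by case: eqP => // _ a0; rewrite a0 eqxx in a_neq0.
have t1_gt0 : 0 < t - 1 by lia.
(* Within one block a vertex is determined by its residue modulo t - 1. *)
pose h (i : 'I_t) : 'I_(t - 1) := Ordinal (ltn_pmod (f i) t1_gt0).
suff /leq_card : injective h by rewrite !card_ord; lia.
move=> i j /(congr1 val) /= hij; apply/f_inj/val_inj => /=.
rewrite (divn_eq (f i) (t - 1)) (divn_eq (f j) (t - 1)) hij.
by have := same_block i; rewrite -(same_block j) /block => ->.
Qed.

End LowerBound.

Theorem theorem4p2 (t : nat) (ht : 8 <= t) :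
  is_gallai_ramsey 4 (path_graph 5) (pineapple t 5) (4 * t - 3).
Proof.
split=> [|M [_ M_bound]].
  split=> [|n n_ge c]; last exact: gallai_ramsey_upper.
  by apply: (@leq_trans 'C(4, 2)) => //; apply: leq_bin2l; lia.
rewrite leqNgt; apply/negP => M_lt.
have t_ge5 : 5 <= t by lia.
(* A bound [M] applies to every larger order, in particular to 4t - 4. *)
have [|/block_coloring_no_rainbow|/block_coloring_no_monochromatic] :=
    M_bound (4 * (t - 1)) _ _ (block_coloring_exact t_ge5 (erefl _)); by [lia | apply].
Qed.
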